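(* For all positive integers $n$ and $q$, the burning number of the Hamming graph $H(n,q)$ satisfies \[ \beta(H(n,q))\leq \left\lfloor\left(1-\tfrac1q\right)n+\tfrac{q+1}2\right\rfloor . \]
   Context: Let $[q]:=\{0,1,\ldots,q-1\}$. The Hamming graph $H(n,q)$ has vertex set $[q]^n$, and two vertices are adjacent if and only if they differ in exactly one coordinate. For a finite graph $G$ with vertex set $V$ and graph distance $d$, and a vertex $x$ and non-negative integer $k$, let $\Gamma_k(x)=\{y\in V: d(x,y)\leq k\}$. A sequence $x_0,x_1,\ldots,x_b\in V$ is a burning sequence of length $b+1$ if $\bigcup_{k=0}^{b}\Gamma_{b-k}(x_k)=V$. The burning number $\beta(G)$ is the minimum length of a burning sequence of $G$. *)

(* Defs.v *)
From mathcomp Require Import all_boot all_order all_algebra.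

Set Implicit Arguments.
Unset Strict Implicit.
Unset Printing Implicit Defensive.

Record sgraph := SGraph {
  vertex :> finType;
  adj : rel vertex;
  adj_sym : symmetric adj;
  adj_irrefl : irreflexive adj
}.

Section Burning.
Variable G : sgraph.
Implicit Types x y : G.

Definition walk x y (l : nat) : bool :=
  [exists p : l.-tuple G, path (@adj G) x p && (last x p == y)].

Lemma connect_walk x y : connect (@adj G) x y -> exists l, walk x y l.
Proof.
case/connectP=> p Gp ->; exists (size p).
by apply/existsP; exists (in_tuple p); rewrite /= Gp eqxx.
Qed.

(* [None] stands for infinite distance. *)
Definition dist x y : option nat :=
  match @idP (connect (@adj G) x y) with
  | ReflectT xy => Some (ex_minn (connect_walk xy))
  | ReflectF _ => None
  end.

Definition ball (k : nat) x : {set G} :=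
  [set y | if dist x y is Some d then d <= k else false].

(* A sequence of length l = b + 1, so that b - k is l.-1 - k.  The empty
   sequence burns only the empty graph. *)
Definition burning_sequence (l : nat) (s : l.-tuple G) : bool :=
  \bigcup_(k < l) ball (l.-1 - k) (tnth s k) == [set: G].

Definition burnable (l : nat) : bool :=
  [exists s : l.-tuple G, burning_sequence s].

Lemma mem_ball k x : x \in ball k x.
Proof.
rewrite inE /dist; case: {-}_ / idP => [xx|]; last by rewrite connect0.
case: ex_minnP => m _ /(_ 0) m_min; apply: leq_trans (m_min _) (leq0n k).
by apply/existsP; exists [tuple]; rewrite /= eqxx.
Qed.

Lemma ex_burnable : exists l, burnable l.
Proof.
exists #|G|; apply/existsP; exists (enum_tuple G).
apply/eqP/setP=> x; rewrite inE; apply/bigcupP; exists (enum_rank x) => //.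
have -> : tnth (enum_tuple G) (enum_rank x) = x.
  by rewrite (tnth_nth x) /= nth_enum_rank.
exact: mem_ball.
Qed.

Definition burning_number : nat := ex_minn ex_burnable.

End Burning.

Section Hamming.
Variables n q : nat.
Implicit Types x y : {ffun 'I_n -> 'I_q}.

Definition hamming_adj x y : bool := #|[set i | x i != y i]| == 1.

Lemma hamming_adj_sym : symmetric hamming_adj.
Proof.
move=> x y; rewrite /hamming_adj; congr (#|pred_of_set _| == 1).
by apply/setP=> i; rewrite !inE eq_sym.
Qed.

Lemma hamming_adj_irrefl : irreflexive hamming_adj.
Proof.
move=> x; rewrite /hamming_adj; suff -> : [set i | x i != x i] = set0.
  by rewrite cards0.
by apply/setP=> i; rewrite !inE eqxx.
Qed.

Definition hamming : sgraph := SGraph hamming_adj_sym hamming_adj_irrefl.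

End Hamming.

(* Main.v *)
Require Import Defs.
From mathcomp Require Import all_boot all_order all_algebra.
From mathcomp Require Import zify ring.

(** Burn the constant words [0^n, ..., (q-1)^n] in this order.  A word in which
    the letter [j] occurs [c_j] times is at distance [n - c_j] from [j^n], so a
    word missed by a sequence of length [l >= q] has [c_j <= n - l + j] for all
    [j < q].  Summing over [j] gives [n <= q (n - l) + q (q - 1) / 2], which
    fails as soon as [l > (1 - 1/q) n + (q - 1) / 2].  When the bound is less
    than [q], it exceeds the diameter [n], and one word suffices. *)

Set Implicit Arguments.
Unset Strict Implicit.
Unset Printing Implicit Defensive.

Lemma walk_in_ball (G : sgraph) (x y : G) (l k : nat) :
  walk x y l -> l <= k -> y \in ball k x.
Proof.
move=> w lk; rewrite inE /dist; case: {-}_ / idP => [xy|nxy].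
  by case: ex_minnP => m _ /(_ _ w) /leq_trans; apply.
case: nxy; case/existsP: w => p /andP[Gp /eqP <-].
by apply/connectP; exists p.
Qed.

Lemma walk_cons (G : sgraph) (x z y : G) (l : nat) :
  adj x z -> walk z y l -> walk x y l.+1.
Proof.
move=> xz /existsP[p Gp]; apply/existsP; exists [tuple of z :: p].
by rewrite /= xz.
Qed.

(** Overwriting one disagreeing coordinate of [x] with the letter of [y] is an edge and lowers the
    number of disagreements by one. *)
Lemma hamming_walk (n q : nat) (x y : hamming n q) :
  walk x y #|[set i | x i != y i]|.
Proof.
move: {2}#|_| (erefl #|[set i | x i != y i]|) => m.
elim: m x => [|m IHm] x dxy; rewrite dxy.
  apply/existsP; exists [tuple] => /=; apply/eqP/ffunP => i.
  by move/eqP: dxy; rewrite cards_eq0 => /eqP/setP/(_ i); rewrite !inE => /negbFE/eqP.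
have /card_gt0P[i] : 0 < #|[set i | x i != y i]| by rewrite dxy.
rewrite inE => xyi.
pose z : hamming n q := [ffun j => if j == i then y i else x j].
have dzy : #|[set j | z j != y j]| = m.
  apply/eqP; rewrite -eqSS -dxy (cardsD1 i [set j | x j != y j]) inE xyi add1n eqSS.
  apply/eqP; congr #|pred_of_set _|; apply/setP => j; rewrite !inE ffunE.
  by case: (eqVneq j i) => [->|]; rewrite ?eqxx.
have := IHm z dzy; rewrite dzy; apply: walk_cons.
rewrite /= /hamming_adj; apply/cards1P; exists i; apply/setP => j.
by rewrite !inE ffunE; case: (eqVneq j i) => [->|]; rewrite ?xyi ?eqxx.
Qed.

Lemma hamming_ball (n q k : nat) (x y : hamming n q) :
  #|[set i | x i != y i]| <= k -> y \in ball k x.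
Proof. exact/walk_in_ball/hamming_walk. Qed.

Lemma sum_letter_count (n q : nat) (y : {ffun 'I_n -> 'I_q}) :
  \sum_(j < q) #|[set i | y i == j]| = n.
Proof.
rewrite -[RHS](card_ord n) -sum1_card (partition_big y predT) //=.
by apply: eq_bigr => j _; rewrite -sum1_card; apply: eq_bigl => i; rewrite inE.
Qed.

Lemma dist_constant_word (n q : nat) (y : {ffun 'I_n -> 'I_q}) (j : 'I_q) :
  #|[set i | [ffun _ : 'I_n => j] i != y i]| + #|[set i | y i == j]| = n.
Proof.
rewrite -[RHS](card_ord n) -(cardsC [set i | y i == j]) addnC.
congr (_ + #|pred_of_set _|).
by apply/setP => i; rewrite !inE ffunE eq_sym.
Qed.

(** The last hypothesis is [l > (1 - 1/q) n + (q - 1)/2] with denominators cleared. *)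
Lemma hamming_burnable (n q l : nat) :
  0 < q -> 0 < l -> n < l \/ q <= l ->
  2 * (q.-1 * n) + q * q.-1 < 2 * (q * l) -> burnable (hamming n q) l.
Proof.
move=> q0 l0 nql lbig; apply/existsP.
(* Reduction mod [q] only supplies a letter for [k >= q]; below [q] it changes nothing. *)
pose c (k : nat) : hamming n q := [ffun _ => Ordinal (ltn_pmod k q0)].
exists [tuple c k | k < l]; apply/eqP/setP => y; rewrite inE.
apply/negbNE/negP => /bigcupP ycov.
have miss (k : 'I_l) : l.-1 - k < #|[set i | c k i != y i]|.
  rewrite ltnNge; apply/negP => dk; apply: ycov; exists k => //.
  by rewrite tnth_mktuple; apply: hamming_ball.
(* If [n < l], the first ball has radius [l - 1 >= n] and misses no word. *)
have ql : q <= l.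
  case: nql => // nl; have := leq_trans (miss (Ordinal l0)) (max_card _).
  by rewrite card_ord /=; lia.
(* Since [j < q <= l], the truncated radius [l.-1 - j] is the true difference. *)
have cle (j : 'I_q) : #|[set i | y i == j]| + l <= n + j.
  have cj : c j = [ffun _ => j].
    by apply/ffunP => i; rewrite !ffunE; apply/val_inj; rewrite /= modn_small.
  have dj : #|[set i | c j i != y i]| + #|[set i | y i == j]| = n.
    by rewrite cj; apply: dist_constant_word.
  have mj : l.-1 - j < #|[set i | c j i != y i]| := miss (widen_ord ql j).
  by have := ltn_ord j; lia.
have: \sum_(j < q) (#|[set i | y i == j]| + l) <= \sum_(j < q) (n + j).
  by apply: leq_sum => j _.
rewrite !big_split /= sum_letter_count !sum_nat_const card_ord.
rewrite -(big_mkord xpredT id) bin2_sum bin2 => sum_le.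
have : 2 * (q * q.-1)./2 <= q * q.-1 by lia.
have : q * n = q.-1 * n + n by rewrite -{1}(prednK q0) mulSn addnC.
by move: sum_le lbig; lia.
Qed.

Local Open Scope ring_scope.

Theorem theorem2 (n q : nat) (hn : (0 < n)%N) (hq : (0 < q)%N) :
  (burning_number (hamming n q))%:Z <=
    Num.floor ((1 - 1 / q%:R) * n%:R + (q%:R + 1) / 2 : rat).
Proof.
(* [N / (2q)] is the claimed bound before rounding, so [l] is its floor. *)
pose N := (2 * (q.-1 * n) + q * q.+1)%N; pose l := (N %/ (2 * q))%N.
have N_ge : (2 * (q * l) <= N)%N by rewrite mulnA mulnC leq_divM.
have N_lt : (N < 2 * (q * l) + 2 * q)%N.
  by rewrite mulnA -mulnSr mulnC -ltn_divLR // muln_gt0.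
have qE : q = q.-1.+1 by rewrite prednK.
have bl : burnable (hamming n q) l.
  apply: hamming_burnable => //; first by rewrite divn_gt0 ?muln_gt0 // /N; nia.
  (* If [l <= n], replacing [n] by [l] in [N < 2q(l + 1)] leaves [q(q - 1) < 2l], and
     [(q - 1)(q - 2) >= 0] then gives [q <= l]. *)
  - by have [nl|ln] := ltnP n l; [left | right; rewrite /N in N_lt; nia].
  (* This is [N_lt] less [2q] on each side, as [q(q + 1) - 2q = q(q - 1)]. *)
  - by rewrite /N in N_lt; nia.
apply: (@Order.POrderTheory.le_trans _ _ l%:Z).
  by rewrite lez_nat /burning_number; case: ex_minnP => m _; apply.
rewrite Num.Theory.floor_ge_int -[_%:~R]/(l%:R).
have q0 : 0 < q%:R :> rat by rewrite Num.Theory.ltr0n.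
have -> : (1 - 1 / q%:R) * n%:R + (q%:R + 1) / 2 = N%:R / (2 * q%:R) :> rat.
  rewrite /N; move: q0; rewrite qE /= => q0.
  by field; rewrite GRing.nat1r Num.Theory.lt0r_neq0.
rewrite Num.Theory.ler_pdivlMr ?Num.Theory.mulr_gt0 //.
by rewrite -!GRing.natrM Num.Theory.ler_nat; lia.
Qed.
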